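(* Let $p,q\in\mathbb{C}$ with $|p|>1$, and let $\{w_n\}_{n\geq -1}$ be a solution of the difference equation $w_{n+1}=\dfrac{w_{n-1}}{p+qw_n+w_{n-1}}$, $n=0,1,\ldots$. Then for every $\epsilon>0$ such that $\epsilon<\dfrac{|p|-1}{|q|+1}$ and every $n\geq 0$, if $w_n\in B(0,\epsilon)$ and $w_{n-1}\in B(0,\epsilon)$, then $w_{n+1}\in B(0,\epsilon)$.
   Context: $B(0,\epsilon)=\{z\in\mathbb{C}:|z|<\epsilon\}$ is the open ball. A solution is a sequence of complex numbers satisfying the recursion, whose initial conditions $w_{-1},w_0$ are such that the denominator never vanishes. *)

(* Defs.v *)
From Stdlib Require Export Reals ZArith.
From Coquelicot Require Export Coquelicot.

(* The Euclidean disc B(c, r); Coquelicot's [ball] on [C] is the sup-norm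
   ball of R * R, hence not the notion wanted here. *)
Definition open_disc (c : C) (r : R) (z : C) : Prop := (Cmod (z - c)%C < r)%R.

Definition denominator (p q : C) (w : Z -> C) (n : Z) : C :=
  (p + q * w n + w (n - 1)%Z)%C.

(* A sequence (w_n) for n >= -1 is a function on Z whose values at indices
   below -1 are never used. Since division by 0 is total in Rocq, the
   requirement that the denominators do not vanish is explicit. *)
Definition is_solution (p q : C) (w : Z -> C) : Prop :=
  forall n : Z, (0 <= n)%Z ->
    denominator p q w n <> RtoC 0 /\
    w (n + 1)%Z = (w (n - 1)%Z / denominator p q w n)%C.

(* Main.v *)
Require Import Defs.
From Stdlib Require Import Reals ZArith Lra.
From Coquelicot Require Import Coquelicot.

(** The bound on [eps] says exactly that [eps * (|q| + 1) < |p| - 1]. Hence, as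
    long as two consecutive terms lie in the disc of radius [eps] about 0, the
    perturbation [q * w n + w (n - 1)] of [p] has modulus less than [|p| - 1],
    and the denominator has modulus greater than 1
    ([Cmod_perturbation_gt_1]). Dividing [w (n - 1)] by it can only decrease
    the modulus, so the next term stays in the disc. *)

Lemma open_disc_0 (r : R) (z : C) : open_disc (RtoC 0) r z <-> (Cmod z < r)%R.
Proof.
  unfold open_disc.
  now replace (z - RtoC 0)%C with z by ring.
Qed.

(** Reverse triangle inequality: [p] is the perturbed value minus [q * a + b],
    whose modulus is at most [eps * (|q| + 1)]. *)
Lemma Cmod_perturbation_gt_1 (p q a b : C) (eps : R) :
  (eps < (Cmod p - 1) / (Cmod q + 1))%R ->
  (Cmod a < eps)%R -> (Cmod b < eps)%R ->
  (1 < Cmod (p + q * a + b)%C)%R.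
Proof.
  intros heps ha hb.
  pose proof (Cmod_ge_0 q) as hq.
  assert (hsmall : (eps * (Cmod q + 1) < Cmod p - 1)%R).
  { apply Rlt_div_r; [lra | exact heps]. }
  assert (hqa : (Cmod q * Cmod a <= Cmod q * eps)%R).
  { apply Rmult_le_compat_l; lra. }
  pose proof (Cmod_triangle (p + q * a + b) (- (q * a + b))) as hp.
  replace (p + q * a + b + - (q * a + b))%C with p in hp by ring.
  rewrite Cmod_opp in hp.
  pose proof (Cmod_triangle (q * a) b) as hab.
  rewrite Cmod_mult in hab.
  lra.
Qed.

Lemma Cmod_div_le (z d : C) : (1 < Cmod d)%R -> (Cmod (z / d)%C <= Cmod z)%R.
Proof.
  intros hd.
  rewrite Cmod_div by (apply Cmod_gt_0; lra).
  apply Rle_div_l; [lra |].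
  rewrite <- (Rmult_1_r (Cmod z)) at 1.
  apply Rmult_le_compat_l; [apply Cmod_ge_0 | lra].
Qed.

Theorem theorem4p3 (p q : C) (w : Z -> C)
  (hp : (1 < Cmod p)%R) (hw : is_solution p q w) :
  forall eps : R, (0 < eps)%R -> (eps < (Cmod p - 1) / (Cmod q + 1))%R ->
  forall n : Z, (0 <= n)%Z ->
    open_disc (RtoC 0) eps (w n) -> open_disc (RtoC 0) eps (w (n - 1)%Z) ->
    open_disc (RtoC 0) eps (w (n + 1)%Z).
Proof.
  intros eps _ heps n hn ha hb.
  apply (proj1 (open_disc_0 _ _)) in ha, hb.
  apply (proj2 (open_disc_0 _ _)).
  rewrite (proj2 (hw n hn)).
  apply Rle_lt_trans with (2 := hb).
  apply Cmod_div_le.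
  now apply Cmod_perturbation_gt_1 with eps.
Qed.
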